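(* Let $b>0$, let $k\in L^1(0,b)$ be a kernel satisfying the generalized Sonine condition (gSC), and let $f\in C^1[0,b]$. Then the integral equation $$\int_0^t k(t-s)u(s)\,ds=f(t)\quad\text{for almost all } t\in(0,b)$$ admits a unique solution $u\in L^1(0,b)$.
   Context: All functions are real-valued. Let $b>0$. A kernel $k\in L^1(0,b)$ is said to satisfy the generalized Sonine condition (gSC) if there exist $K\in L^1(0,b)$ and a function $g:[0,b]\to\mathbb{R}$, continuous on $[0,b]$ and differentiable on $(0,b)$, with $g'\in L^1(0,b)$ and $g(0)=1$, such that $$\int_0^t K(t-s)k(s)\,ds=g(t)\quad\text{for almost all } t\in(0,b).$$ Uniqueness in $L^1(0,b)$ is understood up to equality almost everywhere. *)

(* Defs.v *)
From HB Require Import structures.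
From mathcomp Require Import all_boot all_order all_algebra.
From mathcomp Require Import all_classical all_reals all_analysis.

Set Implicit Arguments.
Unset Strict Implicit.
Unset Printing Implicit Defensive.

Import Order.TTheory GRing.Theory Num.Theory.
Import numFieldNormedType.Exports.

Local Open Scope classical_set_scope.
Local Open Scope ring_scope.

Section Definitions.
Context {R : realType}.
Implicit Types (a b t : R) (f g k u v K : R -> R).

Notation mu := (@lebesgue_measure R).

(* An element of L^1(0,b) is given by a Borel representative; its values
   outside ]0, b[ play no role, and elements are identified by [eq_ae_on]. *)
Definition L1_on b u : Prop := mu.-integrable `]0, b[ (EFin \o u).

Definition eq_ae_on b u v : Prop := u = v %[ae mu in `]0, b[%classic].

(* The integral is extended-real valued. For t in ]0, b[ and k, u Borel on
   ]0, b[ it is finite exactly when the integrand is absolutely integrable on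
   ]0, t[ (oo - oo is -oo), so that an equation with a finite right-hand side
   asserts integrability too. *)
Definition convolution k u t : \bar R :=
  (\int[mu]_(s in `]0%R, t[) (k (t - s) * u s)%:E)%E.

Definition convolution_eq b k u f : Prop :=
  convolution k u = (EFin \o f) %[ae mu in `]0, b[%classic].

Definition gSC b k : Prop :=
  exists K g : R -> R,
    [/\ L1_on b K,
        {within `[0, b], continuous g},
        {in `]0, b[, forall t, derivable g t 1},
        L1_on b (g^`())%classic &
        g 0 = 1 /\ convolution_eq b K k g].

(* C^1[a,b]: the limit of the difference quotient is taken inside [a, b], hence
   it is one-sided at the endpoints. *)
Definition C1_on a b f : Prop :=
  exists2 df : R -> R,
    {within `[a, b], continuous df} &
    {in `[a, b], forall x,
      (f y - f x) / (y - x) @[y --> within `[a, b] x^'] --> df x}.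

End Definitions.

(* Main.v *)
From HB Require Import structures.
Require Import Defs.
From mathcomp Require Import all_boot all_order all_algebra.
From mathcomp Require Import all_classical all_reals all_analysis.
From mathcomp Require Import measurable_realfun ring lra.

Set Implicit Arguments.
Unset Strict Implicit.
Unset Printing Implicit Defensive.

Import Order.TTheory GRing.Theory Num.Theory.
Import numFieldNormedType.Exports.

Local Open Scope classical_set_scope.
Local Open Scope ring_scope.

(** Write a * c for the convolution on ]0, b[ of integrable functions extended
    by zero; up to a.e. equality this product is commutative and associative
    ([starC], [starA]). Let 1 be the constant function, so that 1 * w is the
    primitive of w vanishing at 0. As g(0) = 1 and g is the primitive of its
    derivative, the Sonine condition says K * k = 1 + 1 * g', whence
    K * (k * w) = 1 * (w + g' * w) for every w ([sonine_star]).

    Two facts about the right-hand side carry the proof. First, 1 * w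
    determines w, by Lebesgue differentiation ([star_one_inj]). Second, the
    Volterra equation of the second kind w + h * w = F has exactly one solution
    in L^1 for every kernel h in L^1 ([volterra], [volterra_uniq]).
    Multiplication by exp (c t) is an automorphism of the convolution algebra
    and, for c near -oo, it brings the norm of h below 1; then the Banach
    fixed point theorem applies.

    Uniqueness: if k * w = 0 then 1 * (w + g' * w) = 0, hence w = 0
    ([sonine_kernel_inj]). By commutativity, K * r = 0 implies r = 0 as well.
    Existence: f = f(0) 1 + 1 * f'. Let u solve u + g' * u = f(0) K + K * f'.
    Then K * (k * u) = 1 * (f(0) K + K * f') = K * f, that is
    K * (k * u - f) = 0, and so k * u = f ([sonine_equation_solvable]).

    The delicate point is that g is the primitive of its derivative
    ([integral_derive1]): g' exists everywhere but is merely integrable, so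
    that g is not known to be absolutely continuous beforehand. For a
    truncation max(g', -m) from below, the primitive P of max(g', -m) + m is
    nondecreasing, and it has the right derivative off a null set N. Adding
    a small multiple of a bounded nondecreasing function with infinite
    derivative on N ([steep_function]) and a small linear term yields a function
    whose difference with g(t) + m t increases to the right of every point
    ([le_of_right_dini]). This bounds the increment of g by the integral of
    max(g', -m); letting m tend to infinity gives one inequality, and the other
    one is the same statement for -g. *)

(** * Invariance of the Lebesgue measure under reflections and translations *)

Section Reflection.
Context {R : realType}.
Notation mu := (@lebesgue_measure R).

Lemma measurable_subr_cst (t : R) : measurable_fun setT (fun s : R => t - s).
Proof. by apply: measurable_funB => //; exact: measurable_cst. Qed.

Lemma lebesgue_measure_reflect (t : R) (A : set R) : measurable A ->
  mu ((fun s => t - s) @^-1` A) = mu A.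
Proof.
move=> mA; apply/esym.
pose f : R -> measurableTypeR R := fun s => t - s.
have mf : measurable_fun setT f by exact: measurable_subr_cst.
pose fm : {mfun _ >-> _} := HB.pack f (isMeasurableFun.Build _ _ _ _ _ mf).
pose m := pushforward mu fm.
rewrite -[RHS]/(m A).
apply: lebesgue_measure_unique => //= _ [[x y]] _ <-.
rewrite /m /pushforward.
rewrite (_ : fm @^-1` _ = `[t - y, t - x[%classic); last first.
  by apply/seteqP; split => s /=; rewrite !in_itv/= /f => /andP[? ?];
    apply/andP; split; lra.
rewrite !lebesgue_measure_itv/= !lte_fin -!EFinB.
by rewrite ltrD2l ltrN2; case: ifP => // _; congr (_%:E); lra.
Qed.

Lemma ge0_integral_reflect (t : R) (f : R -> \bar R) : measurable_fun setT f ->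
  (forall s, 0 <= f s)%E ->
  (\int[mu]_s f (t - s)%R = \int[mu]_s f s)%E.
Proof.
move=> mf f0.
pose r : measurableTypeR R -> measurableTypeR R := fun s => t - s.
have mr : measurable_fun setT r by exact: measurable_subr_cst.
have -> : (\int[mu]_s f (t - s)%R = \int[pushforward mu r]_s f s)%E.
  by rewrite (ge0_integral_pushforward mr).
by apply: eq_measure_integral => A mA _; exact: (lebesgue_measure_reflect t mA).
Qed.

Lemma integral_reflect (t : R) (f : R -> \bar R) : measurable_fun setT f ->
  (\int[mu]_s f (t - s)%R = \int[mu]_s f s)%E.
Proof.
move=> mf; rewrite [LHS]integralE [RHS]integralE; congr (_ - _)%E.
- under eq_integral do rewrite (funepos_comp f (fun s => t - s)).
  by rewrite ge0_integral_reflect//; exact: measurable_funepos.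
- under eq_integral do rewrite (funeneg_comp f (fun s => t - s)).
  by rewrite ge0_integral_reflect//; exact: measurable_funeneg.
Qed.

(** A translation is the composition of two reflections. *)
Lemma integral_translate (s : R) (f : R -> \bar R) : measurable_fun setT f ->
  (\int[mu]_t f (t - s)%R = \int[mu]_t f t)%E.
Proof.
move=> mf; rewrite -(integral_reflect 0 mf) -(integral_reflect s).
  by apply: eq_integral => t _; congr (f _); lra.
apply: (measurableT_comp mf).
by apply: measurable_funB => //; exact: measurable_cst.
Qed.

End Reflection.

(** * The L^1 seminorm *)

Section L1norm.
Context d (T : measurableType d) (R : realType).
Variable mu : {measure set T -> \bar R}.
Implicit Types f g : T -> R.
Notation int f := (mu.-integrable setT (EFin \o f)).

Definition L1norm f : R := \int[mu]_x `|f x|.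

Lemma L1normE f : int f -> (L1norm f)%:E = (\int[mu]_x `|f x|%:E)%E.
Proof.
move=> intf; rewrite fineK//; apply: integrable_fin_num => //.
exact: integrable_norm.
Qed.

Lemma L1norm_ge0 f : 0 <= L1norm f.
Proof. exact: Rintegral_ge0. Qed.

Lemma integrable_measurable f : int f -> measurable_fun setT f.
Proof. by move=> /measurable_int/measurable_EFinP. Qed.

Lemma measurable_norm_integrable f :
  int f -> measurable_fun setT (fun x => `|f x|%:E).
Proof.
move=> /integrable_measurable mf; apply/measurable_EFinP.
exact: measurableT_comp.
Qed.

Lemma integrable_le f g : measurable_fun setT f -> int g ->
  (\forall x \ae mu, `|f x| <= `|g x|) -> int f.
Proof.
move=> mf intg fg; apply/integrableP; split; first exact/measurable_EFinP.
have /integrableP[mg] := intg; apply: le_lt_trans.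
apply: ae_ge0_le_integral => //.
- by apply/measurableT_comp => //; exact/measurable_EFinP.
- by apply/measurableT_comp.
- by apply: filterS fg => x fgx _; rewrite /= lee_fin.
Qed.

Lemma L1norm_le f g : int f -> int g ->
  (\forall x \ae mu, `|f x| <= `|g x|) -> L1norm f <= L1norm g.
Proof.
move=> intf intg fg; rewrite -lee_fin !L1normE//.
apply: ae_ge0_le_integral => //.
- exact: measurable_norm_integrable intf.
- exact: measurable_norm_integrable intg.
- by apply: filterS fg => x fgx _; rewrite lee_fin.
Qed.

Lemma integrable_add f g : int f -> int g -> int (fun x => f x + g x).
Proof. exact: integrableD. Qed.

Lemma integrable_sub f g : int f -> int g -> int (fun x => f x - g x).
Proof. exact: integrableB. Qed.

Lemma integrable_scale r f : int f -> int (fun x => r * f x).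
Proof. exact: integrableZl. Qed.

Lemma L1normD f g : int f -> int g ->
  L1norm (fun x => f x + g x) <= L1norm f + L1norm g.
Proof.
move=> intf intg.
rewrite /L1norm -RintegralD//; [|exact: integrable_norm..].
apply: le_Rintegral => //; last by move=> x _; exact: ler_normD.
- exact/integrable_norm/integrable_add.
- by apply: integrable_add; exact: integrable_norm.
Qed.

Lemma L1norm_eq0 f : int f -> L1norm f = 0 -> f = cst 0 %[ae mu].
Proof.
move=> intf f0.
have := @ae_eq_integral_abs _ _ _ mu _ measurableT (EFin \o f)
  (measurable_int mu intf).
move=> [+ _] => /(_ _)/wrap[]; first by rewrite -L1normE// f0.
by apply: filterS => x /(_ Logic.I)[] + _.
Qed.

End L1norm.

(** * Convolution on the real line *)

Section LebesgueAeFilter.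
Context {R : realType}.

#[export] Instance ae_lebesgue_filter :
  Filter (nbhs (almost_everywhere (@lebesgue_measure R))).
Proof. exact: (ae_filter_ringOfSetsType (@lebesgue_measure R)). Qed.

End LebesgueAeFilter.

Section Convolution.
Context {R : realType}.
Notation mu := (@lebesgue_measure R).
Implicit Types a c d : R -> R.
Notation int f := (mu.-integrable setT (EFin \o f)).

(** The integral is truncated to a real number: at the points where the
    integrand is not integrable, which form a null set, the value is 0. *)
Definition lconv a c (t : R) : R := \int[mu]_s (a (t - s) * c s).

Lemma measurable_lconv_kernel a c : int a -> int c ->
  measurable_fun setT (fun z : R * R => a (z.1 - z.2) * c z.2).
Proof.
move=> /integrable_measurable ma /integrable_measurable mc.
apply: measurable_funM; last exact: measurableT_comp.
by apply: measurableT_comp => //; exact: measurable_funB.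
Qed.

Lemma measurable_lconv_integrand a c (t : R) : int a -> int c ->
  measurable_fun setT (fun s : R => a (t - s) * c s).
Proof.
move=> /integrable_measurable ma /integrable_measurable mc.
apply: measurable_funM => //.
by apply: measurableT_comp => //; exact: measurable_subr_cst.
Qed.

Lemma integral_norm_lconv_kernel a c : int a -> int c ->
  (\int[mu]_s \int[mu]_t `|a ((t : R) - s)%R * c s|%:E =
    (L1norm mu a * L1norm mu c)%:E)%E.
Proof.
move=> inta intc; have ma := integrable_measurable inta.
under eq_integral => s _.
  under eq_integral do rewrite normrM mulrC EFinM.
  rewrite ge0_integralZl_EFin//; last first.
    apply/measurable_EFinP/measurableT_comp => //.
    apply: (measurableT_comp ma).
    by apply: measurable_funB => //; exact: measurable_cst.
  rewrite (integral_translate s (f := fun x => `|a x|%:E)); last first.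
    exact/measurable_EFinP/measurableT_comp.
  rewrite -L1normE// muleC.
  over.
rewrite /= ge0_integralZl_EFin ?L1norm_ge0//; last first.
  exact: (measurable_norm_integrable intc).
by rewrite -L1normE.
Qed.

Lemma integrable_lconv_kernel a c : int a -> int c ->
  (mu \x mu)%E.-integrable setT
    (fun z : R * R => (a (z.1 - z.2) * c z.2)%:E).
Proof.
move=> inta intc; apply/integrable21ltyP.
  by apply/measurable_EFinP; exact: (measurable_lconv_kernel inta intc).
by rewrite /= integral_norm_lconv_kernel// ltry.
Qed.

Lemma ae_integrable_lconv a c : int a -> int c ->
  \forall t \ae mu, int (fun s => a (t - s) * c s).
Proof.
move=> inta intc.
exact: ae_integrable1 (integrable_lconv_kernel inta intc).
Qed.

Lemma integrable_lconv a c : int a -> int c -> int (lconv a c).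
Proof.
move=> inta intc.
have /integrable_fubini_F iF := integrable_lconv_kernel inta intc.
have mF : measurable_fun setT (EFin \o lconv a c).
  apply/measurable_EFinP.
  exact: (measurableT_comp (fine_measurable measurableT) (measurable_int _ iF)).
apply/integrableP; split => //.
have /integrableP[_] := iF; apply: le_lt_trans.
apply: ge0_le_integral => //.
- exact: measurableT_comp.
- by apply: measurableT_comp => //; exact: measurable_int _ iF.
- move=> t _; rewrite /= /lconv /Rintegral /fubini_F.
  by case: (\int[mu]_s _)%E => //= *; rewrite ?normr0 ?leey.
Qed.

Lemma L1norm_lconv a c : int a -> int c ->
  L1norm mu (lconv a c) <= L1norm mu a * L1norm mu c.
Proof.
move=> inta intc; rewrite -lee_fin L1normE; last exact: integrable_lconv.
have mnk : measurable_fun setT (fun z : R * R => `|a (z.1 - z.2) * c z.2|%:E).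
  apply/measurable_EFinP/measurableT_comp => //.
  exact: (measurable_lconv_kernel inta intc).
rewrite -integral_norm_lconv_kernel//.
have /= <- := fubini_tonelli (m1 := mu) (m2 := mu) _ mnk
  (fun z => normr_ge0 _).
apply: ge0_le_integral => //.
- apply/measurable_EFinP/measurableT_comp => //.
  exact: (integrable_measurable (integrable_lconv inta intc)).
- exact: (measurable_fun_fubini_tonelli_F (m2 := mu) _ mnk
    (fun z => normr_ge0 _)).
- move=> t _.
  rewrite /lconv /Rintegral.
  apply: (@le_trans _ _ `|\int[mu]_s (a (t - s) * c s)%:E|)%E.
    by case: (\int[mu]_s _)%E => //= *; rewrite ?normr0 ?leey.
  apply: le_abse_integral => //.
  by apply/measurable_EFinP; exact: (measurable_lconv_integrand _ inta intc).
Qed.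

Lemma lconvC a c : int a -> int c -> lconv a c = lconv c a.
Proof.
move=> inta intc; apply/funext => t; rewrite /lconv /Rintegral; congr fine.
rewrite -(integral_reflect t); last first.
  by apply/measurable_EFinP; exact: (measurable_lconv_integrand _ inta intc).
by apply: eq_integral => s _; rewrite subKr mulrC.
Qed.

Lemma eq_lconv a c c' : int a -> int c -> int c' -> c = c' %[ae mu] ->
  lconv a c = lconv a c'.
Proof.
move=> inta intc intc' cc'; apply/funext => t; rewrite /lconv /Rintegral.
congr fine; apply: ae_eq_integral => //.
- by apply/measurable_EFinP; exact: (measurable_lconv_integrand _ inta intc).
- by apply/measurable_EFinP; exact: (measurable_lconv_integrand _ inta intc').
- by apply: filterS cc' => s /(_ Logic.I) -> _.
Qed.

Lemma lconvDr a c d : int a -> int c -> int d ->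
  lconv a (fun s => c s + d s) = (fun t => lconv a c t + lconv a d t) %[ae mu].
Proof.
move=> inta intc intd.
move: (ae_integrable_lconv inta intc) (ae_integrable_lconv inta intd).
apply: filterS2 => t ic id _; rewrite /lconv -RintegralD//.
by apply: eq_Rintegral => s _; rewrite mulrDr.
Qed.

Lemma lconvZr r a c : int a -> int c ->
  lconv a (fun s => r * c s) = (fun t => r * lconv a c t) %[ae mu].
Proof.
move=> inta intc; apply: filterS (ae_integrable_lconv inta intc) => t ic _.
by rewrite /lconv -RintegralZl//; apply: eq_Rintegral => s _; rewrite mulrCA.
Qed.

(** Both sides are iterated integrals of a(t - s) c(s - r) d(r) over (s, r).
    By Tonelli this kernel is integrable as soon as |a| * (|c| * |d|) is
    finite at t. *)
Lemma lconvA a c d : int a -> int c -> int d ->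
  lconv a (lconv c d) = lconv (lconv a c) d %[ae mu].
Proof.
move=> inta intc intd.
have mcd := measurable_lconv_kernel intc intd.
have ia' := integrable_norm inta.
have ic' := integrable_norm intc.
have id' := integrable_norm intd.
apply: filterS (ae_integrable_lconv ia' (integrable_lconv ic' id')) => t it _.
pose F (z : R * R) := a (t - z.1) * (c (z.1 - z.2) * d z.2).
have mF : measurable_fun setT F.
  apply: measurable_funM => //.
  apply: (measurableT_comp (integrable_measurable inta)).
  by apply: measurable_funB => //; exact: measurable_cst.
have iF : (mu \x mu)%E.-integrable setT (EFin \o F).
  apply/integrable12ltyP; first exact/measurable_EFinP.
  have /integrableP[_] := it; apply: le_lt_trans.
  apply: ae_ge0_le_integral => //.
  - by move=> s _; exact: integral_ge0.
  - apply: (measurable_fun_fubini_tonelli_F (m2 := mu)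
      (fun z : R * R => `|(F z)%:E|%E)) => //.
    by apply: measurableT_comp => //; exact/measurable_EFinP.
  - by apply: measurableT_comp => //; exact: measurable_int _ it.
  apply: filterS (ae_integrable_lconv intc intd) => s is_ _.
  have -> : (\int[mu]_y `|(EFin \o F) (s, y)| =
      \int[mu]_y (`|a (t - s)|%:E * `|c (s - y) * d y|%:E))%E.
    by apply: eq_integral => y _; rewrite /F /= normrM EFinM.
  rewrite ge0_integralZl_EFin//; last first.
    exact: (measurable_norm_integrable is_).
  rewrite -(L1normE is_)// -EFinM /= lee_fin [X in _ <= X]ger0_norm; last first.
    apply: mulr_ge0 => //; apply: Rintegral_ge0 => r _.
    by apply: mulr_ge0 => /=; exact: normr_ge0.
  rewrite ler_wpM2l// le_eqVlt; apply/orP; left; apply/eqP.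
  by apply: eq_Rintegral => y _; exact: normrM.
have := Fubini iF => /(congr1 fine).
have -> : fine (\int[mu]_s \int[mu]_r (EFin \o F) (s, r))%E =
    lconv a (lconv c d) t.
  congr fine; apply: ae_eq_integral => //.
  - exact: measurable_fubini_F iF.
  - apply/measurable_EFinP.
    exact: (measurable_lconv_integrand _ inta (integrable_lconv intc intd)).
  apply: filterS (ae_integrable_lconv intc intd) => s is_ _.
  rewrite EFinM /lconv /Rintegral fineK; last exact: integrable_fin_num.
  by rewrite -integralZl//; apply: eq_integral => r _; rewrite /= EFinM.
move=> ->; congr fine; apply: ae_eq_integral => //.
- exact: measurable_fubini_G iF.
- apply/measurable_EFinP.
  exact: (measurable_lconv_integrand _ (integrable_lconv inta intc) intd).
apply: filterS (ae_integrable2 iF) => r ir _.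
(* The s-section at r is integrable, and d r can be divided out unless it
   vanishes; this makes the truncated value of the convolution exact. *)
have [dr0|dr0] := eqVneq (d r) 0.
  rewrite dr0 mulr0 -[RHS](integral0 mu setT).
  by apply: eq_integral => s _; rewrite /F /= dr0 !mulr0.
have ir' : int (fun s => a (t - s) * c (s - r)).
  have := @integrable_scale _ _ _ mu (d r)^-1 _ ir.
  congr (mu.-integrable _ _); apply/funext => s /=; congr EFin.
  by rewrite /F /= (mulrA (a _)) (mulrC _ (d r)) mulKf.
have mac : measurable_fun setT (fun s : R => a (t - r - s) * c s).
  exact: (measurable_lconv_integrand _ inta intc).
have Es : (\int[mu]_s (a (t - r - (s : R))%R * c s)%:E =
    \int[mu]_s (a (t - (s : R))%R * c ((s : R) - r)%R)%:E)%E.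
  rewrite -(integral_translate r (f := fun s : R => (a (t - r - s) * c s)%:E)).
    by apply: eq_integral => s _; congr (a _ * _)%:E; lra.
  exact/measurable_EFinP.
rewrite EFinM /lconv /Rintegral Es fineK; last exact: integrable_fin_num.
rewrite -integralZr//; apply: eq_integral => s _.
by rewrite /F /= -EFinM mulrA.
Qed.

End Convolution.

(** * The Banach fixed point theorem in L^1 *)

Section FixedPoint.
Context d (X : measurableType d) (R : realType).
Variable mu : {measure set X -> \bar R}.
Notation int f := (mu.-integrable setT (EFin \o f)).

Lemma geometric_sum_le (q : R) n : 0 <= q < 1 ->
  \sum_(0 <= i < n) q ^+ i <= (1 - q)^-1.
Proof.
move=> /andP[q0 q1]; rewrite -[leRHS]mul1r ler_pdivlMr ?subr_gt0//.
suff -> : (\sum_(0 <= i < n) q ^+ i) * (1 - q) = 1 - q ^+ n.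
  by rewrite lerBlDr lerDl exprn_ge0.
elim: n => [|n IH]; first by rewrite big_nil mul0r expr0 subrr.
by rewrite big_nat_recr//= mulrDl IH exprS; ring.
Qed.

(** The Riesz-Fischer argument: the sum W of the absolute values of the
    increments is integrable, hence finite a.e.; where it is finite the
    sequence converges, and W dominates it. *)
Lemma L1_cvg_of_summable_increments (u : nat -> X -> R) (M : R) :
  u 0%N = cst 0 -> (forall n, int (u n)) ->
  (forall n, \sum_(0 <= i < n) L1norm mu (fun x => u i.+1 x - u i x) <= M) ->
  exists U, int U /\ L1norm mu (fun x => u n x - U x) @[n --> \oo] --> 0.
Proof.
move=> u0 intu DM.
pose v n x := u n.+1 x - u n x.
have intv n : int (v n) by exact: integrable_sub.
pose W x := (\sum_(n <oo) `|v n x|%:E)%E.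
have W0 x : (0 <= W x)%E by apply: nneseries_ge0 => *; rewrite lee_fin.
have mv n : measurable_fun setT (fun x => `|v n x|%:E).
  exact: (measurable_norm_integrable (intv n)).
have mW : measurable_fun setT W by apply: ge0_emeasurable_sum => *.
have iW : mu.-integrable setT W.
  apply/integrableP; split => //.
  under eq_integral do rewrite gee0_abs//.
  rewrite integral_nneseries//.
  apply: (@le_lt_trans _ _ M%:E); last exact: ltry.
  apply: lime_le; first by apply: is_cvg_nneseries => *; exact: integral_ge0.
  apply: nearW => n; rewrite (eq_bigr (fun i => (L1norm mu (v i))%:E)).
    by rewrite sumEFin lee_fin; exact: DM.
  by move=> i _; rewrite (L1normE (intv i)).
have uE n x : u n x = series (fun i => v i x) n.
  elim: n => [|n IH]; first by rewrite u0 /series /= big_geq.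
  by rewrite seriesSr -IH /v; ring.
have uW n x : (`|u n x|%:E <= W x)%E.
  rewrite uE /series /=.
  apply: (@le_trans _ _ (\sum_(0 <= i < n) `|v i x|%:E)%E).
    by rewrite sumEFin lee_fin; exact: ler_norm_sum.
  by apply: nneseries_lim_ge => *; rewrite lee_fin.
(* The upper limit is measurable without any convergence assumption. *)
pose U x := fine (limn_esup (fun n => (u n x)%:E)).
have mU : measurable_fun setT U.
  apply: (measurableT_comp (fine_measurable measurableT)).
  apply: measurable_fun_limn_esup => n.
  exact: measurable_int (intu n).
have cvgU : {ae mu, forall x, setT x -> (u n x)%:E @[n --> \oo] --> (U x)%:E}.
  have := integrable_ae measurableT iW; apply: filterS => x /(_ Logic.I) Wfin _.
  have cu : cvgn (u ^~ x).
    rewrite (_ : u ^~ x = series (fun i => v i x)); last exact/funext.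
    apply: normed_cvg; apply: nondecreasing_is_cvgn.
      apply/nondecreasing_seqP => n; rewrite [leRHS]seriesSr lerDl.
      exact: normr_ge0.
    exists (fine (W x)) => _ [n _ <-]; rewrite -lee_fin fineK//.
    rewrite /series /= -sumEFin.
    by apply: nneseries_lim_ge => *; rewrite lee_fin.
  have ce : (u n x)%:E @[n --> \oo] --> (limn (u ^~ x))%:E.
    by apply: cvg_EFin; [exact: nearW|exact: cu].
  by rewrite /U (cvg_limn_einf_sup ce).2.
have [iU cv _] := dominated_convergence measurableT
  (fun n => measurable_int _ (intu n)) (proj2 (measurable_EFinP _ _) mU)
  cvgU iW (aeW mu (fun x n _ => uW n x)).
exists U; split => //.
move: cv => /fine_cvgP[_]; apply: cvg_trans; apply: near_eq_cvg.
exact: nearW.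
Qed.

(** Functions are not identified a.e. here, so that the fixed point equation
    can only hold a.e. *)
Lemma L1_banach_fixed_point (T : (X -> R) -> (X -> R)) (q : R) : 0 <= q < 1 ->
  (forall u, int u -> int (T u)) ->
  (forall u v, int u -> int v ->
    L1norm mu (fun x => T u x - T v x) <= q * L1norm mu (fun x => u x - v x)) ->
  exists u, int u /\ T u = u %[ae mu].
Proof.
move=> q01 iT cT; have /andP[q0 q1] := q01.
pose u n := iter n T (cst 0).
have i0 : int (cst 0) by exact: integrable0.
have iu n : int (u n) by elim: n => //= n; exact: iT.
pose D n := L1norm mu (fun x => u n.+1 x - u n x).
have DE n : D n <= q ^+ n * D 0%N.
  elim: n => [|n IH]; first by rewrite expr0 mul1r.
  by rewrite exprS -mulrA (le_trans (cT _ _ (iu n.+1) (iu n)))// ler_wpM2l.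
have D0 : 0 <= D 0%N by exact: L1norm_ge0.
have [U [iU uU]] : exists U, int U /\
    L1norm mu (fun x => u n x - U x) @[n --> \oo] --> 0.
  apply: (@L1_cvg_of_summable_increments u ((1 - q)^-1 * D 0%N)) => // n.
  apply: (@le_trans _ _ (\sum_(0 <= i < n) (q ^+ i * D 0%N))).
    by apply: ler_sum => i _; exact: DE.
  by rewrite -mulr_suml ler_wpM2r// geometric_sum_le.
exists U; split => //.
have iTU := iT _ iU.
suff TU0 : L1norm mu (fun x => T U x - U x) = 0.
  have := L1norm_eq0 (integrable_sub iTU iU) TU0.
  by apply: filterS => x /(_ Logic.I)/eqP; rewrite subr_eq0 => /eqP.
apply/eqP; rewrite eq_le L1norm_ge0 andbT.
have cv : q * L1norm mu (fun x => u n x - U x) +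
    L1norm mu (fun x => u n.+1 x - U x) @[n --> \oo] --> (q * 0 + 0 : R).
  apply: cvgD; first exact: cvgMr.
  move: uU.
  by rewrite -(cvg_shiftS (fun n => L1norm mu (fun x => u n x - U x))).
rewrite mulr0 addr0 in cv.
apply: (cvgr_to_ge cv); apply: nearW => n.
apply: (@le_trans _ _ (L1norm mu (fun x => T U x - T (u n) x) +
    L1norm mu (fun x => u n.+1 x - U x))); last first.
  rewrite lerD2r (le_trans (cT _ _ iU (iu n)))// ler_wpM2l//.
  by rewrite /L1norm; under eq_Rintegral do rewrite distrC.
apply: le_trans (L1normD (integrable_sub iTU (iT _ (iu n)))
  (integrable_sub (iu n.+1) iU)).
rewrite le_eqVlt; apply/orP; left; apply/eqP; apply: eq_Rintegral => x _.
by congr (`|_|); rewrite /=; ring.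
Qed.

End FixedPoint.

(** * Increase from one-sided information *)

Section Dini.
Context {R : realType}.
Implicit Types (G P f : R -> R) (a b t x : R).

(** P may jump, but only upwards: hence, for x inside ]a, b[, the supremum c
    of the points up to which G + P stays above its value at x still has this
    property, and if c < b, moving to the right of c contradicts maximality.
    The left endpoint a is reached afterwards by letting x tend to a, because nothing
    is known about the increments to the right of a itself. *)
Lemma le_of_right_dini G P a b : a < b -> {within `[a, b], continuous G} ->
  {homo P : x y / x <= y} ->
  (forall t, a < t < b -> \forall s \near t^'+, G t + P t <= G s + P s) ->
  G a + P a <= G b + P b.
Proof.
move=> ab cG ndP dini.
have /(continuous_within_itvP _ ab)[cGi cGa cGb] := cG.
have cGl t : a < t <= b -> G @ t^'- --> G t.
  move=> /andP[at_]; rewrite le_eqVlt => /predU1P[->//|tb].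
  by apply/cvg_at_left_filter/cGi; rewrite in_itv/= at_.
suff inner x : a < x -> x < b -> G x + P x <= G b + P b.
  rewrite -lerBrDr; apply: (cvgr_to_le cGa); near=> x.
  have ax : a < x by near: x; exact: nbhs_right_gt.
  have xb : x < b by near: x; exact: nbhs_right_lt.
  by rewrite lerBrDr (le_trans _ (inner x ax xb))// lerD2l ndP// ltW.
move=> ax xb.
pose S := [set t | x <= t <= b /\
  forall s, x <= s <= t -> G x + P x <= G s + P s].
have Sx : S x.
  split; first by rewrite lexx ltW.
  by move=> s; rewrite andbC => /le_anti ->.
have hS : has_sup S.
  by split; [exists x|exists b => t [/andP[]]].
pose c := sup S.
have xc : x <= c by exact: sup_upper_bound.
have cb : c <= b by apply: ge_sup => [|t [/andP[]]//]; exists x.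
have below s : x <= s < c -> G x + P x <= G s + P s.
  move=> /andP[xs sc].
  have [t [_ tS] st] : exists2 t, S t & s < t.
    have := @sup_adherent _ S (c - s); rewrite subr_gt0 => /(_ sc hS)[t St].
    by rewrite -/c subKr => ?; exists t.
  by apply: tS; rewrite xs ltW.
have Sc : G x + P x <= G c + P c.
  move: xc; rewrite le_eqVlt => /predU1P[<-//|xc].
  rewrite -lerBlDr; have cl := cGl c _.
  apply: (cvgr_to_ge (cl _)); first by rewrite (lt_trans ax xc).
  near=> s; rewrite lerBlDr (le_trans (below s _))//.
    apply/andP; split; last by near: s; exact: nbhs_left_lt.
    by near: s; exact: nbhs_left_ge.
  by rewrite lerD2l ndP//; near: s; exact: nbhs_left_le.
move: cb; rewrite le_eqVlt => /predU1P[<-//|cb].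
exfalso; have acb : a < c < b by rewrite (lt_le_trans ax xc).
have [d /= d0 dS] := dini c acb.
pose e := Num.min (d / 2) (b - c).
have e0 : 0 < e by rewrite lt_min divr_gt0// subr_gt0.
have : c + e <= c.
  apply: sup_upper_bound => //; split.
    by rewrite (le_trans xc) ?lerDl ?(ltW e0)//= -lerBrDl ge_min lexx orbT.
  move=> s /andP[xs sce].
  have [sc|cs|->//] := ltgtP s c; first by apply: below; rewrite xs.
  apply: (le_trans Sc); apply: dS => //=.
  rewrite distrC gtr0_norm ?subr_gt0// ltrBlDl (le_lt_trans sce)// ltrD2l.
  by rewrite gt_min ltr_pdivrMr// ltr_pMr// ltr1n.
by rewrite gerDl leNgt e0.
Unshelve. all: by end_near. Qed.

Lemma right_increase_of_derive_gt0 f t (l : R) : is_derive t 1 f l -> 0 < l ->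
  \forall s \near t^'+, f t < f s.
Proof.
move=> fl l0; have fd : derivable f t 1 by [].
have fl' : h^-1 *: ((f \o shift t) (h *: 1) - f t) @[h --> 0^'] --> l.
  by rewrite -[l](@derive_val _ _ _ _ _ _ _ fl); exact: fd.
have [d /= d0 dl] := cvgr_gt _ fl' _ l0.
exists d => //= s std ts.
have := dl (s - t); rewrite /= sub0r normrN distrC => /(_ std).
rewrite subr_eq0 gt_eqF// => /(_ isT).
rewrite /shift /= [_ *: 1]mulr1 subrK.
by rewrite pmulr_rgt0 ?invr_gt0 ?subr_gt0// subr_gt0.
Qed.

End Dini.

(** * Nondecreasing functions that are steep on a null set *)

Section Steep.
Context {R : realType}.
Notation mu := (@lebesgue_measure R).

(** Cover N by open sets U n of measure at most 2^-(n+1), and let psi x be the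
    sum over n of the measures of U n below x. To the right of a point
    of N, the first m terms alone grow with slope m. *)
Lemma steep_function (N : set R) : mu.-negligible N ->
  exists psi : R -> R, [/\ {homo psi : x y / x <= y},
    (forall x, 0 <= psi x <= 1) &
    forall x, N x -> forall A : R,
      \forall s \near x^'+, A * (s - x) <= psi s - psi x].
Proof.
move=> [N' [mN' N'0 NN']].
have N'oo : (mu N' < +oo)%E by rewrite N'0 ltry.
pose e n : R := 1 / (2 ^ n.+1)%:R.
have e0 n : 0 < e n by rewrite divr_gt0.
have /choice[U HU] n : exists U : set R,
    [/\ open U, N' `<=` U & (mu U <= (e n)%:E)%E].
  have [U [oU NU UN]] := lebesgue_regularity_outer mN' N'oo (e0 n).
  exists U; split => //.
  have mU := open_measurable oU.
  have UN' : (mu N' + mu (U `\` N') <= (e n)%:E)%E by rewrite N'0 add0e ltW.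
  rewrite -(setDUK NU); apply: le_trans UN'; apply: measureU2 => //.
  exact: measurableD.
have mU n : measurable (U n) by apply: open_measurable; have [] := HU n.
pose w n x : \bar R := mu (U n `&` `]-oo, x]%classic).
have w0 n x : (0 <= w n x)%E by exact: measure_ge0.
have mUi n (i : interval R) : measurable (U n `&` [set` i]).
  by apply: measurableI => //; exact: measurable_itv.
have we n x : (w n x <= (e n)%:E)%E.
  have [_ _] := HU n; apply: le_trans.
  apply: le_measure => //; rewrite inE; [exact: mUi|exact: mU].
pose W x := (\sum_(n <oo) w n x)%E.
have W0 x : (0 <= W x)%E by apply: nneseries_ge0.
have W1 x : (W x <= 1%:E)%E.
  apply: le_trans (epsilon_trick0 xpredT ler01).
  by apply: lee_nneseries.
have Wfin x : W x \is a fin_num.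
  by rewrite ge0_fin_numE// (le_lt_trans (W1 x))// ltry.
have wsplit n x y : x <= y -> w n y = (w n x + mu (U n `&` `]x, y]%classic))%E.
  move=> xy; rewrite /w -measureU; [|exact: mUi|exact: mUi|]; last first.
    apply/seteqP; split => // z /= [[_ +] [_ +]].
    by rewrite !in_itv/= => zx /andP[]; rewrite ltNge zx.
  rewrite -setIUr; congr (lebesgue_measure (_ `&` _)).
  by rewrite -itv_bndbnd_setU// bnd_simp.
have Wsplit x y : x <= y ->
    W y = (W x + \sum_(n <oo) mu (U n `&` `]x, y]%classic))%E.
  move=> xy; rewrite /W -nneseriesD//.
  by apply: eq_eseriesr => n _; exact: wsplit.
exists (fine \o W); split.
- move=> x y xy /=; apply: fine_le => //; rewrite (Wsplit _ _ xy).
  by rewrite leeDl// nneseries_ge0.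
- move=> x /=; rewrite fine_ge0//= -lee_fin fineK//.
- move=> x /NN' Nx A.
  have [m Am] : exists m, A <= m%:R.
    by exists (Num.truncn A).+1; rewrite ltW// truncnS_gt.
  have : \forall s \near x^'+, forall n : 'I_m, `[x, s] `<=` U n.
    apply: filter_forall => n; have [oU N'U _] := HU n.
    have [d /= d0 dU] := open_nbhs_nbhs (conj oU (N'U _ Nx)).
    exists d => //= s sd xs z; rewrite /= in_itv/= => /andP[xz zs].
    apply: dU => /=; apply: le_lt_trans sd.
    by rewrite !(distrC x) !ger0_norm ?subr_ge0 ?lerB// ltW.
  move=> H; near=> s.
  have xs : x < s by near: s; exact: nbhs_right_gt.
  have HU' : forall n : 'I_m, `[x, s] `<=` U n by near: s; exact: H.
  rewrite /= -lee_fin EFinB !fineK// (Wsplit _ _ (ltW xs)).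
  rewrite addeAC subee// add0e.
  apply: (@le_trans _ _ (\sum_(0 <= n < m) mu (U n `&` `]x, s]%classic))%E);
    last exact: nneseries_lim_ge.
  rewrite big_mkord (eq_bigr (fun=> (s - x)%:E)); last first.
    move=> n _; rewrite setIidr; last first.
      by apply: subset_trans (HU' n); exact: subset_itv_oc_cc.
    by rewrite lebesgue_measure_itv/= lte_fin xs EFinB.
  rewrite sumEFin sumr_const card_ord lee_fin -[leRHS]mulr_natl ler_wpM2r//.
  by rewrite subr_ge0 ltW.
Unshelve. all: by end_near. Qed.

End Steep.

(** * The fundamental theorem for everywhere differentiable functions *)

Section FTC.
Context {R : realType}.
Notation mu := (@lebesgue_measure R).
Implicit Types (g : R -> R) (a b : R).

Lemma integrable_restrictT (D : set R) (f : R -> R) : measurable D ->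
  mu.-integrable D (EFin \o f) -> mu.-integrable setT (EFin \o (f \_ D)).
Proof.
move=> mD iD; have [+ _] := @integrable_mkcond _ _ _ mu D (EFin \o f) mD.
by rewrite restrict_EFin; exact.
Qed.

Lemma integrable_itv_cst a b (k : R) : mu.-integrable `]a, b[ (EFin \o cst k).
Proof.
apply: measurable_bounded_integrable => //; last exact: bounded_cst.
by rewrite /= lebesgue_measure_itv/=; case: ifPn => // _; rewrite -EFinB ltry.
Qed.

Section UpperBound.
Variables (a b : R) (g : R -> R).
Hypothesis ab : a < b.
Hypothesis cg : {within `[a, b], continuous g}.
Hypothesis dg : {in `]a, b[, forall t, derivable g t 1}.
Hypothesis ig : mu.-integrable `]a, b[ (EFin \o g^`()%classic).

Let dg' t : a < t < b -> is_derive t 1 g (g^`()%classic t).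
Proof.
by move=> tab; rewrite derive1E; apply: derivableP; apply: dg; rewrite in_itv.
Qed.

Let mg : measurable_fun `]a, b[ g^`()%classic.
Proof. by apply/measurable_EFinP; exact: measurable_int ig. Qed.

Let truncated_integrable (m : R) :
  mu.-integrable `]a, b[ (EFin \o (fun t => Num.max (g^`()%classic t) (- m))).
Proof.
have ib : mu.-integrable `]a, b[
    (EFin \o (fun t => `|g^`()%classic t| + `|m|)).
  exact: (integrableD _ (integrable_norm ig) (integrable_itv_cst a b `|m|)).
apply: le_integrable ib => //.
  by apply/measurable_EFinP; exact: measurable_maxr.
move=> t _ /=; rewrite lee_fin.
rewrite [leRHS]ger0_norm ?addr_ge0//.
by case: (leP (g^`()%classic t) (- m)) => _; rewrite ?normrN ?lerDl ?lerDr.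
Qed.

(** The truncation makes q = max(g', -m) + m nonnegative, so that its
    primitive P0 is nondecreasing everywhere, including the null set N where
    it need not be differentiable. *)
Lemma increment_le_integral_truncated (m : R) :
  g b - g a <= \int[mu]_(t in `]a, b[) Num.max (g^`()%classic t) (- m).
Proof.
pose q t := Num.max (g^`()%classic t) (- m) + m.
have q0 t : 0 <= q t by rewrite /q -lerBlDr sub0r le_max lexx orbT.
have iq : mu.-integrable `]a, b[ (EFin \o q).
  exact: (integrableD _ (truncated_integrable m) (integrable_itv_cst a b m)).
pose p := q \_ `]a, b[.
have ip : mu.-integrable setT (EFin \o p) by exact: integrable_restrictT.
have p0 t : 0 <= p t by rewrite /p patchE; case: ifP.
have ipS (D : set R) : measurable D -> mu.-integrable D (EFin \o p).
  by move=> mD; apply: integrableS ip.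
pose P0 t := \int[mu]_(s in `]-oo, t]) p s.
have P0B x y : x <= y -> P0 y - P0 x = \int[mu]_(s in `]x, y]) p s.
  by move=> xy; apply: Rintegral_itvB => //; exact: ipS.
have P0nd : {homo P0 : x y / x <= y}.
  by move=> x y xy; rewrite -subr_ge0 P0B//; exact: Rintegral_ge0.
have [N nN NP0] : exists2 N, mu.-negligible N &
    forall t, ~ N t -> is_derive t 1 P0 (p t).
  have lp : locally_integrable [set: R] p.
    by apply: open_integrable_locally => //; exact: openT.
  have aeP := @FTC1Ny _ p (fun y => ipS _ (measurable_itv _)) lp.
  exists (~` [set t | derivable P0 t 1 /\ P0^`()%classic t = p t]) => //.
  by move=> t /contrapT[dP <-]; rewrite derive1E; exact: derivableP.
have [psi [psi_nd psi01 psi_steep]] := steep_function nN.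
have key (e : R) : 0 < e ->
    g b - g a <= P0 b - P0 a - m * (b - a) + e * (b - a) + e.
  move=> e0.
  pose G s := - g s + (e - m) * s.
  pose P s := P0 s + e * psi s.
  have : G a + P a <= G b + P b.
    apply: le_of_right_dini => //.
    - have cm : {within `[a, b], continuous (fun s => (e - m) * s)}.
        by apply: continuous_subspaceT => y; exact: mulrl_continuous.
      by move=> x; apply: cvgD; [apply: cvgN; exact: cg|exact: cm].
    - move=> x y xy; apply: lerD; first exact: P0nd.
      by rewrite ler_wpM2l ?psi_nd// ltW.
    - move=> t tab; have dgt := dg' tab.
      have [Nt|Nt] := pselect (N t).
        (* P0 need not be differentiable at t, but it is nondecreasing, and
           the slope A of e * psi beats that of G. *)
        pose A := `|g^`()%classic t| + `|e - m| + 1.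
        have dH : is_derive t 1 (fun s => - g s + (e - m) * s + A * s)
            (- g^`()%classic t + (e - m) *: 1 + A *: 1).
          by apply: is_deriveD.
        have H0 : 0 < - g^`()%classic t + (e - m) *: 1 + A *: 1.
          rewrite /A ![_ *: 1]mulr1.
          have := ler_norm (g^`()%classic t); have := ler_norm (- (e - m)).
          by rewrite normrN; lra.
        have st := psi_steep t Nt (A / e).
        have rH := right_increase_of_derive_gt0 dH H0.
        near=> s.
        have ts : t < s by near: s; exact: nbhs_right_gt.
        have : - g t + (e - m) * t + A * t < - g s + (e - m) * s + A * s.
          by near: s.
        have : A / e * (s - t) <= psi s - psi t by near: s.
        rewrite -(ler_pM2l e0) mulrA (mulrC e (A / e)) divfK ?gt_eqF//.
        rewrite mulrBr => st'.
        have := P0nd _ _ (ltW ts).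
        rewrite /G /P; lra.
      have dPt := NP0 t Nt.
      have dH : is_derive t 1 (fun s => - g s + (e - m) * s + P0 s)
          (- g^`()%classic t + (e - m) *: 1 + p t).
        by apply: is_deriveD.
      have H0 : 0 < - g^`()%classic t + (e - m) *: 1 + p t.
        rewrite [_ *: 1]mulr1 /p patchE mem_set /= ?in_itv//= /q.
        have : g^`()%classic t <= Num.max (g^`()%classic t) (- m).
          by rewrite le_max lexx.
        lra.
      have rH := right_increase_of_derive_gt0 dH H0.
      near=> s.
      have ts : t < s by near: s; exact: nbhs_right_gt.
      have : - g t + (e - m) * t + P0 t < - g s + (e - m) * s + P0 s by near: s.
      have := psi_nd _ _ (ltW ts); rewrite -(ler_pM2l e0).
      rewrite /G /P; lra.
  rewrite /G /P.
  have /andP[pa _] := psi01 a; have /andP[_ pb] := psi01 b.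
  have epa := mulr_ge0 (ltW e0) pa.
  have epb : e * psi b <= e by rewrite ger_pMr.
  lra.
(* b - a + 1 absorbs both error terms of the previous step. *)
have gP : g b - g a <= P0 b - P0 a - m * (b - a).
  apply/ler_addgt0Pr => e e0.
  have ba1 : 0 < b - a + 1 by rewrite addr_gt0// subr_gt0.
  have := key (e / (b - a + 1)) (divr_gt0 e0 ba1).
  by rewrite -addrA -[X in _ + (_ + X)]mulr1 -mulrDr divfK// gt_eqF.
apply: (le_trans gP); rewrite (P0B _ _ (ltW ab)).
rewrite -Rintegral_itv_bndo_bndc; last exact: ipS.
have -> : \int[mu]_(t in `]a, b[) p t = \int[mu]_(t in `]a, b[) q t.
  by apply: eq_Rintegral => t tab; rewrite /p patchE tab.
rewrite RintegralD//; last exact: integrable_itv_cst.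
rewrite Rintegral_cst// /= lebesgue_measure_itv/= lte_fin ab -EFinB/=.
by rewrite addrK.
Unshelve. all: by end_near. Qed.

Lemma increment_le_integral_derive1 :
  g b - g a <= \int[mu]_(t in `]a, b[) g^`()%classic t.
Proof.
have mu_ n :
    measurable_fun `]a, b[ (fun t => Num.max (g^`()%classic t) (- n%:R)).
  exact: measurable_maxr.
have [| |_ _] := @dominated_convergence _ _ _ mu _ (measurable_itv `]a, b[)
  (fun n t => (Num.max (g^`()%classic t) (- n%:R))%:E)
  (EFin \o g^`()%classic) (fun t => `|g^`()%classic t|%:E)
  (fun n => proj2 (measurable_EFinP _ _) (mu_ n))
  (measurable_int _ ig) _ (integrable_norm ig) _.
- apply: aeW => t _; apply: cvg_near_cst.
  exists (Num.truncn `|g^`()%classic t|).+1 => // n /= tn.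
  congr EFin; apply/max_idPl; rewrite lerNl.
  rewrite (le_trans (ler_norm _))// normrN.
  by rewrite (le_trans (ltW (truncnS_gt _)))// ler_nat.
- apply: aeW => t n _; rewrite /= lee_fin.
  case: (leP (g^`()%classic t) (- n%:R)) => // tn.
  rewrite normrN ger0_norm//.
  by have := ler_norm (- g^`()%classic t); rewrite normrN; lra.
have Ifin : (\int[mu]_(t in `]a, b[) (EFin \o g^`()%classic) t)%E \is a fin_num.
  exact: integrable_fin_num.
rewrite -[X in _ --> X -> _](fineK Ifin) => /fine_cvgP[_ cv].
apply: (cvgr_to_ge cv); apply: nearW => n.
exact: increment_le_integral_truncated.
Qed.

End UpperBound.

(** Differentiability at every point of ]a, b[, rather than at almost every
    one, is what excludes singular functions such as Cantor's. *)
Theorem integral_derive1 a b g : a < b -> {within `[a, b], continuous g} ->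
  {in `]a, b[, forall t, derivable g t 1} ->
  mu.-integrable `]a, b[ (EFin \o g^`()%classic) ->
  g b - g a = \int[mu]_(t in `]a, b[) g^`()%classic t.
Proof.
move=> ab cg dg ig; apply/eqP; rewrite eq_le increment_le_integral_derive1//=.
have dN : {in `]a, b[, (\- g)^`()%classic =1 \- g^`()%classic}.
  by move=> t tab; rewrite /= !derive1E; exact: (deriveN (dg t tab)).
have iN : mu.-integrable `]a, b[ (EFin \o (\- g)^`()%classic).
  apply: (@eq_integrable _ _ _ mu _ (measurable_itv _)
    (EFin \o (\- g^`()%classic))).
    by move=> t /set_mem tab; rewrite /= dN.
  exact: (integrableN ig).
have cN : {within `[a, b], continuous (\- g)}.
  by move=> x; apply: cvgN; exact: cg.
have dNg : {in `]a, b[, forall t, derivable (\- g) t 1}.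
  by move=> t tab; exact: (derivableN (dg t tab)).
have := increment_le_integral_derive1 ab cN dNg iN.
have -> : \int[mu]_(t in `]a, b[) (\- g)^`()%classic t =
    - \int[mu]_(t in `]a, b[) g^`()%classic t.
  rewrite -mulN1r -RintegralZl//; apply: eq_Rintegral => t /set_mem tab /=.
  by rewrite mulN1r dN.
by rewrite /=; lra.
Qed.

End FTC.

(** * The convolution algebra of L^1(0, b) *)

Section Star.
Context {R : realType}.
Notation mu := (@lebesgue_measure R).
Implicit Types a c d f : R -> R.
Notation int f := (mu.-integrable setT (EFin \o f)).
Variable b : R.

Definition cutoff f : R -> R := f \_ `]0, b[.

Lemma cutoffE f t : 0 < t < b -> cutoff f t = f t.
Proof. by move=> tb; rewrite /cutoff patchE mem_set//= in_itv. Qed.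

Lemma cutoff0 f t : ~~ (0 < t < b) -> cutoff f t = 0.
Proof.
by move=> tb; rewrite /cutoff patchE memNset//= in_itv/=; exact/negP.
Qed.

Lemma cutoff_cutoff f : cutoff (cutoff f) = cutoff f.
Proof.
apply/funext => t; have [tb|tb] := boolP (0 < t < b); first by rewrite !cutoffE.
by rewrite !cutoff0.
Qed.

Lemma cutoff_ae f f' : f = f' %[ae mu] -> cutoff f = cutoff f' %[ae mu].
Proof.
apply: filterS => t /(_ Logic.I) ff' _.
by have [tb|tb] := boolP (0 < t < b); [rewrite !cutoffE|rewrite !cutoff0].
Qed.

Lemma cutoff_aeP f f' :
  cutoff f = cutoff f' %[ae mu] <-> f = f' %[ae mu in `]0, b[%classic].
Proof.
split; apply: filterS => t.
  by move=> /(_ Logic.I) + /=; rewrite in_itv/= => + tb; rewrite !cutoffE.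
move=> ff' _; have [tb|tb] := boolP (0 < t < b); last by rewrite !cutoff0.
by rewrite !cutoffE// ff'//= in_itv.
Qed.

Lemma integrable_cutoff f : int f -> int (cutoff f).
Proof.
by move=> intf; apply: integrable_restrictT => //; exact: integrableS intf.
Qed.

Lemma norm_cutoff f t : `|cutoff f t| <= `|f t|.
Proof.
by have [tb|tb] := boolP (0 < t < b); [rewrite cutoffE|rewrite cutoff0 ?normr0].
Qed.

(** L^1(0, b) realized inside L^1 of the line, so that the convolutions below
    are integrals over the whole line. *)
Definition supp_L1 f := int f /\ cutoff f = f.

Lemma supp_L1_int f : supp_L1 f -> int f. Proof. by case. Qed.

Lemma supp_L1_eq0 f t : supp_L1 f -> ~~ (0 < t < b) -> f t = 0.
Proof. by move=> [_ <-]; exact: cutoff0. Qed.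

Lemma supp_L1_cutoff f : int f -> supp_L1 (cutoff f).
Proof.
by move=> intf; split; [exact: integrable_cutoff|exact: cutoff_cutoff].
Qed.

Lemma cutoff_supp_L1 f : L1_on b f -> supp_L1 (cutoff f).
Proof.
by move=> intf; split; [exact: integrable_restrictT|exact: cutoff_cutoff].
Qed.

Lemma supp_L1_on f : supp_L1 f -> L1_on b f.
Proof. by move=> [intf _]; exact: integrableS intf. Qed.

Lemma supp_L1D f f' : supp_L1 f -> supp_L1 f' -> supp_L1 (fun t => f t + f' t).
Proof.
move=> Sf Sf'; split.
  exact: integrable_add (supp_L1_int Sf) (supp_L1_int Sf').
apply/funext => t; have [tb|tb] := boolP (0 < t < b); first by rewrite cutoffE.
by rewrite cutoff0// (supp_L1_eq0 Sf tb) (supp_L1_eq0 Sf' tb) addr0.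
Qed.

Lemma supp_L1Z r f : supp_L1 f -> supp_L1 (fun t => r * f t).
Proof.
move=> Sf; split; first exact: integrable_scale (supp_L1_int Sf).
apply/funext => t; have [tb|tb] := boolP (0 < t < b); first by rewrite cutoffE.
by rewrite cutoff0// (supp_L1_eq0 Sf tb) mulr0.
Qed.

Definition star a c := cutoff (lconv a c).

Lemma starE a c t : 0 < t < b -> star a c t = lconv a c t.
Proof. exact: cutoffE. Qed.

Lemma star0 a c t : ~~ (0 < t < b) -> star a c t = 0.
Proof. exact: cutoff0. Qed.

Lemma supp_L1_star a c : supp_L1 a -> supp_L1 c -> supp_L1 (star a c).
Proof.
by move=> [ia _] [ic _]; apply: supp_L1_cutoff; exact: integrable_lconv.
Qed.

Lemma starC a c : supp_L1 a -> supp_L1 c -> star a c = star c a.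
Proof. by move=> [ia _] [ic _]; rewrite /star lconvC. Qed.

Lemma eq_starr a c c' : supp_L1 a -> supp_L1 c -> supp_L1 c' ->
  c = c' %[ae mu] -> star a c = star a c'.
Proof.
by move=> [ia _] [ic _] [ic' _] cc'; rewrite /star (eq_lconv ia ic ic' cc').
Qed.

Lemma eq_starl a a' c : supp_L1 a -> supp_L1 a' -> supp_L1 c ->
  a = a' %[ae mu] -> star a c = star a' c.
Proof. by move=> Sa Sa' Sc aa'; rewrite !(starC _ Sc)//; exact: eq_starr. Qed.

Lemma lconv_causal a c t : supp_L1 a -> supp_L1 c -> t <= 0 -> lconv a c t = 0.
Proof.
move=> Sa Sc t0; have ac0 s : a (t - s) * c s = 0.
  have [s0|s0] := leP s 0.
    by rewrite (supp_L1_eq0 (t := s) Sc) ?mulr0// negb_and -leNgt s0.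
  rewrite (supp_L1_eq0 (t := t - s) Sa) ?mul0r// negb_and -leNgt.
  by rewrite subr_le0 (le_trans t0 (ltW s0)).
rewrite /lconv; under eq_Rintegral do rewrite ac0.
by rewrite Rintegral_cst// mul0r.
Qed.

(** Causality: values of the inner convolution beyond b do not reach back
    into ]0, b[, so that the inner cutoff can be dropped. *)
Lemma star_lconv a c d : supp_L1 a -> supp_L1 c -> supp_L1 d ->
  star a (star c d) = cutoff (lconv a (lconv c d)).
Proof.
move=> Sa Sc Sd; apply/funext => t.
have [tb|tb] := boolP (0 < t < b); last by rewrite /star !cutoff0.
rewrite /star !cutoffE//; apply: eq_Rintegral => s _.
have [s0|s0] := leP s 0.
  by rewrite cutoff0 ?lconv_causal// negb_and -leNgt s0.
have [sb|bs] := ltP s b; first by rewrite cutoffE// s0.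
rewrite (supp_L1_eq0 (t := t - s) Sa) ?mul0r// negb_and -leNgt subr_le0.
by move: tb => /andP[_ tb]; rewrite (le_trans (ltW tb) bs).
Qed.

Lemma starA a c d : supp_L1 a -> supp_L1 c -> supp_L1 d ->
  star a (star c d) = star (star a c) d %[ae mu].
Proof.
move=> Sa Sc Sd; have [[ia _] [ic _] [id_ _]] := And3 Sa Sc Sd.
rewrite (starC (supp_L1_star Sa Sc) Sd) !star_lconv//.
rewrite (lconvC id_ (integrable_lconv ia ic)).
exact: cutoff_ae (lconvA ia ic id_).
Qed.

Lemma starCA a c d : supp_L1 a -> supp_L1 c -> supp_L1 d ->
  star a (star c d) = star c (star a d) %[ae mu].
Proof.
move=> Sa Sc Sd; move: (starA Sa Sc Sd) (starA Sc Sa Sd).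
apply: filterS2 => t /(_ Logic.I) acd /(_ Logic.I) cad _.
by rewrite acd cad (starC Sa Sc).
Qed.

Lemma star_linear r a c d : supp_L1 a -> supp_L1 c -> supp_L1 d ->
  star a (fun t => r * c t + d t) =
  (fun t => r * star a c t + star a d t) %[ae mu].
Proof.
move=> [ia _] [ic _] [id_ _].
move: (lconvDr ia (integrable_scale r ic) id_) (lconvZr r ia ic).
apply: filterS2 => t /(_ Logic.I) eD /(_ Logic.I) eZ _.
have [tb|tb] := boolP (0 < t < b); last by rewrite !star0// mulr0 addr0.
by rewrite !starE// eD eZ.
Qed.

Lemma starD a c d : supp_L1 a -> supp_L1 c -> supp_L1 d ->
  star a (fun t => c t + d t) = (fun t => star a c t + star a d t) %[ae mu].
Proof.
move=> [ia _] [ic _] [id_ _]; move: (lconvDr ia ic id_).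
apply: filterS => t /(_ Logic.I) eD _.
have [tb|tb] := boolP (0 < t < b); last by rewrite !star0// addr0.
by rewrite !starE.
Qed.

Lemma L1norm_star a c : supp_L1 a -> supp_L1 c ->
  L1norm mu (star a c) <= L1norm mu a * L1norm mu c.
Proof.
move=> [ia _] [ic _]; apply: le_trans (L1norm_lconv ia ic).
have iac := integrable_lconv ia ic.
apply: L1norm_le (integrable_cutoff iac) iac _.
by apply: aeW => t; exact: norm_cutoff.
Qed.

Lemma convolutionE k u t : 0 < t < b ->
  convolution k u t =
  (\int[mu]_s (cutoff k (t - (s : R))%R * cutoff u s)%:E)%E.
Proof.
move=> tb; rewrite /convolution integral_mkcond; apply: eq_integral => s _.
move: tb => /andP[t0 tb].
rewrite patchE; case: ifPn => [|].
  rewrite inE/= in_itv/= => /andP[s0 st]; rewrite !cutoffE//.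
    by rewrite s0 (lt_trans st).
  by rewrite subr_gt0 st ltrBlDr (lt_trans tb)// ltrDl.
rewrite notin_setE/= in_itv/= => /negP; rewrite negb_and -!leNgt => /orP[s0|ts].
  by rewrite [cutoff u s]cutoff0 ?mulr0// negb_and -leNgt s0.
by rewrite [cutoff k _]cutoff0 ?mul0r// negb_and -leNgt subr_le0 ts.
Qed.

(** The equation asserts the finiteness of the integral, which holds for
    almost every t by Fubini. *)
Lemma convolution_eqP k u f : L1_on b k -> L1_on b u ->
  convolution_eq b k u f <-> star (cutoff k) (cutoff u) = cutoff f %[ae mu].
Proof.
move=> /cutoff_supp_L1[ik _] /cutoff_supp_L1[iu _].
split => [H|/cutoff_aeP H].
  apply/cutoff_aeP; move: H; apply: filterS => t H /= tb.
  by rewrite /lconv /Rintegral -convolutionE -?in_itv// H.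
move: (ae_integrable_lconv ik iu) H; apply: filterS2 => t it H /= tb.
rewrite convolutionE -?in_itv// -H// /lconv fineK//.
exact: integrable_fin_num.
Qed.

End Star.

(** * Volterra equations of the second kind *)

Section Volterra.
Context {R : realType}.
Notation mu := (@lebesgue_measure R).
Implicit Types f g h F u w : R -> R.
Notation int f := (mu.-integrable setT (EFin \o f)).
Variable b : R.
Notation supp_L1 := (supp_L1 b).
Notation star := (star b).
Notation cutoff := (cutoff b).

(** The map u |-> F - h * u is a contraction, with constant the norm of h. *)
Lemma volterra_contraction h F : supp_L1 h -> L1norm mu h < 1 -> supp_L1 F ->
  exists u, supp_L1 u /\ (fun t => u t + star h u t) = F %[ae mu].
Proof.
move=> Sh h1 [iF cF]; have [ih _] := Sh.
pose T u := cutoff (fun t => F t - lconv h u t).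
have iT u : int u -> int (T u).
  move=> iu; apply: integrable_cutoff.
  exact: integrable_sub iF (integrable_lconv ih iu).
have q01 : 0 <= L1norm mu h < 1 by rewrite L1norm_ge0.
have cT u v : int u -> int v ->
    L1norm mu (fun t => T u t - T v t) <=
    L1norm mu h * L1norm mu (fun t => u t - v t).
  move=> iu iv; have iuv := integrable_sub iu iv.
  apply: le_trans (L1norm_lconv ih iuv).
  apply: L1norm_le.
  - exact: integrable_sub (iT _ iu) (iT _ iv).
  - exact: integrable_lconv.
  have iNv := integrable_scale (-1) iv.
  move: (lconvDr ih iu iNv) (lconvZr (-1) ih iv).
  apply: filterS2 => t /(_ Logic.I) e1 /(_ Logic.I) e2.
  have -> : lconv h (fun t => u t - v t) t = lconv h u t - lconv h v t.
    rewrite -[- _]mulN1r -e2 -e1; congr (lconv h _ t).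
    by apply/funext => s; rewrite mulN1r.
  rewrite /T; have [tb|tb] := boolP (0 < t < b).
    rewrite !cutoffE// [X in `|X| <= _](_ : _ = - (lconv h u t - lconv h v t)).
      by rewrite normrN.
    by ring.
  by rewrite !cutoff0// subr0 normr0.
have [u [iu Tu]] := L1_banach_fixed_point (mu := mu) q01 iT cT.
have STu : supp_L1 (T u).
  by apply: supp_L1_cutoff; exact: integrable_sub iF (integrable_lconv ih iu).
(* T u, unlike u, vanishes outside ]0, b[, and equals u a.e. *)
exists (T u); split => //; apply: aeW => t _.
have iTu := iT _ iu.
have [tb|tb] := boolP (0 < t < b).
  by rewrite starE// (eq_lconv ih iTu iu Tu) /T cutoffE// subrK.
by rewrite -cF /T star0// !cutoff0// addr0.
Qed.

Lemma volterra_contraction_uniq h w :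
  supp_L1 h -> L1norm mu h < 1 -> supp_L1 w ->
  (fun t => w t + star h w t) = cst 0 %[ae mu] -> w = cst 0 %[ae mu].
Proof.
move=> Sh h1 Sw hw; have [iw _] := Sw.
have [ihw _] := supp_L1_star Sh Sw.
apply: L1norm_eq0 => //; apply/eqP; rewrite eq_le L1norm_ge0 andbT.
have wle : L1norm mu w <= L1norm mu h * L1norm mu w.
  apply: le_trans (L1norm_star Sh Sw); apply: L1norm_le => //.
  move: hw; apply: filterS => t /(_ Logic.I) /eqP.
  by rewrite addr_eq0 => /eqP ->; rewrite normrN.
rewrite leNgt; apply/negP => w0.
by move: wle; rewrite -[leLHS]mul1r ler_pM2r// leNgt h1.
Qed.

Definition weight (c : R) f t := expR (c * t) * f t.

Lemma weightK c : cancel (weight c) (weight (- c)).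
Proof.
move=> f; apply/funext => t; rewrite /weight mulrA -expRD.
by rewrite mulNr addNr expR0 mul1r.
Qed.

Lemma supp_L1_weight c f : supp_L1 f -> supp_L1 (weight c f).
Proof.
move=> Sf; have [iF _] := Sf; split; last first.
  apply/funext => t; have [tb|tb] := boolP (0 < t < b).
    by rewrite cutoffE.
  by rewrite cutoff0// /weight (supp_L1_eq0 Sf tb) mulr0.
apply: (integrable_le _ (integrable_scale (expR (`|c| * `|b|)) iF)).
  apply: measurable_funM; last exact: integrable_measurable iF.
  by apply: measurableT_comp => //; exact: mulrl_measurable.
apply: aeW => t; rewrite /weight; have [/andP[t0 tb]|tb] := boolP (0 < t < b).
  rewrite !normrM ler_wpM2r// !(ger0_norm (expR_ge0 _)) ler_expR.
  rewrite (le_trans (ler_norm _))// normrM ler_wpM2l// !gtr0_norm//.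
    exact: ltW.
  exact: lt_trans tb.
by rewrite (supp_L1_eq0 Sf tb) !mulr0.
Qed.

(** exp (c t) = exp (c (t - s)) exp (c s) under the integral. *)
Lemma weight_star c f g : supp_L1 f -> supp_L1 g ->
  star (weight c f) (weight c g) = weight c (star f g) %[ae mu].
Proof.
move=> [iF _] [ig _].
move: (ae_integrable_lconv iF ig); apply: filterS => t it _.
rewrite /weight; have [tb|tb] := boolP (0 < t < b); last first.
  by rewrite !star0// mulr0.
rewrite !starE// /lconv -RintegralZl//; apply: eq_Rintegral => s _.
rewrite mulrACA -expRD; congr (expR _ * _).
by rewrite -mulrDr subrK.
Qed.

(** Functions in L^1(0, b) vanish for t <= 0, so that exp (- n t) h(t) tends
    to 0 everywhere, dominated by |h|. *)
Lemma weight_norm_lt1 h : supp_L1 h -> exists c, L1norm mu (weight c h) < 1.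
Proof.
move=> Sh; have [ih _] := Sh.
have Sw n := supp_L1_weight (- n%:R) Sh.
have [| |_ + _] := @dominated_convergence _ _ _ mu setT measurableT
  (fun n t => (weight (- n%:R) h t)%:E) (cst 0%E) (fun t => `|h t|%:E)
  (fun n => measurable_int _ (supp_L1_int (Sw n))) (measurable_cst _) _
  (integrable_norm ih) _.
- apply: aeW => t _; rewrite /weight.
  have [/andP[t0 tb]|tb] := boolP (0 < t < b); last first.
    rewrite (supp_L1_eq0 Sh tb); under eq_fun do rewrite mulr0.
    exact: cvg_cst.
  apply: cvg_EFin; first exact: nearW.
  rewrite /comp /= -[X in _ --> X](mul0r (h t)); apply: cvgMl.
  have -> : (fun n => expR (- n%:R * t)) =
      (fun n => expR (- t) ^+ n) :> (nat -> R).
    by apply/funext => n; rewrite -expRM_natl mulNr mulrN.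
  by apply: cvg_expr; rewrite ger0_norm ?expR_ge0// expR_lt1 oppr_lt0.
- apply: aeW => t n _; rewrite /weight /= lee_fin.
  have [/andP[t0 tb]|tb] := boolP (0 < t < b); last first.
    by rewrite (supp_L1_eq0 Sh tb) mulr0.
  rewrite normrM ler_piMl// ger0_norm ?expR_ge0// expR_le1 mulNr oppr_le0.
  by rewrite mulr_ge0// ltW.
move=> /fine_cvgP[_] cv.
have [n _ /(_ n (leqnn _))] := cvgr_lt _ cv _ ltr01.
rewrite /= => hn; exists (- n%:R); move: hn; rewrite /L1norm /Rintegral.
apply: le_lt_trans; rewrite le_eqVlt; apply/orP; left; apply/eqP.
by congr fine; apply: eq_integral => x _; rewrite subr0.
Qed.

Lemma volterra h F : supp_L1 h -> supp_L1 F ->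
  exists u, supp_L1 u /\ (fun t => u t + star h u t) = F %[ae mu].
Proof.
move=> Sh SF; have [c hc] := weight_norm_lt1 Sh.
have Swh := supp_L1_weight c Sh.
have [v [Sv vF]] := volterra_contraction Swh hc (supp_L1_weight c SF).
have Su := supp_L1_weight (- c) Sv.
exists (weight (- c) v); split => //.
have := weight_star (- c) Swh Sv; rewrite weightK.
move: vF; apply: filterS2 => t /(_ Logic.I) vF /(_ Logic.I) -> _.
have -> : F t = expR (- c * t) * weight c F t.
  exact: (congr1 (fun f => f t) (esym (weightK c F))).
by rewrite -vF /weight mulrDr.
Qed.

Lemma volterra_uniq h w : supp_L1 h -> supp_L1 w ->
  (fun t => w t + star h w t) = cst 0 %[ae mu] -> w = cst 0 %[ae mu].
Proof.
move=> Sh Sw hw; have [c hc] := weight_norm_lt1 Sh.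
have Swh := supp_L1_weight c Sh.
have Sww := supp_L1_weight c Sw.
have : weight c w = cst 0 %[ae mu].
  apply: volterra_contraction_uniq Swh hc Sww _.
  move: hw (weight_star c Sh Sw); apply: filterS2.
  move=> t /(_ Logic.I) e1 /(_ Logic.I) -> _.
  by rewrite /weight -mulrDr e1 mulr0.
apply: filterS => t /(_ Logic.I) /eqP e _; move: e.
by rewrite /weight /= mulf_eq0 gt_eqF ?expR_gt0//= => /eqP.
Qed.

End Volterra.

(** * Convolution with the constant 1 *)

Section Primitive.
Context {R : realType}.
Notation mu := (@lebesgue_measure R).
Implicit Types f g w : R -> R.
Variable b : R.
Notation supp_L1 := (supp_L1 b).
Notation star := (star b).
Notation cutoff := (cutoff b).
Notation one := (cutoff (cst 1)).

Lemma supp_L1_one : supp_L1 one.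
Proof. by apply: cutoff_supp_L1; exact: integrable_itv_cst. Qed.

Lemma star_one w t : supp_L1 w -> 0 < t < b ->
  star one w t = \int[mu]_(s in `]-oo, t[) w s.
Proof.
move=> Sw tb; rewrite starE// [RHS]Rintegral_mkcond.
apply: eq_Rintegral => s _; rewrite patchE; case: ifPn.
  rewrite inE/= in_itv/= => st; have [sb|sb] := boolP (0 < s < b).
    rewrite cutoffE ?mul1r// subr_gt0 st.
    move: sb tb => /andP[s0 _] /andP[_ tb].
    by rewrite ltrBlDr (lt_trans tb)// ltrDl.
  by rewrite (supp_L1_eq0 Sw sb) mulr0.
rewrite notin_setE/= in_itv/= => /negP; rewrite -leNgt => ts.
by rewrite cutoff0 ?mul0r// negb_and -leNgt subr_le0 ts.
Qed.

Lemma ae_exists_in_itv (P : R -> Prop) x y : x < y -> (\forall t \ae mu, P t) ->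
  exists2 t, x < t < y & P t.
Proof.
move=> xy [N [mN N0 PN]]; apply: contrapT => nP.
have : (mu `]x, y[%classic <= mu N)%E.
  apply: le_measure; [rewrite inE; exact: measurable_itv|by rewrite inE|].
  move=> t /=; rewrite in_itv/= => txy; apply: PN => /= Pt; apply: nP.
  by exists t.
rewrite N0 lebesgue_measure_itv/= lte_fin xy -EFinB lee_fin leNgt.
by rewrite subr_gt0 xy.
Qed.

(** The primitive P of w vanishes a.e. on ]0, b[ and has derivative w a.e. If
    w t were positive, P would be positive on an interval to the right of t,
    which contains a zero of P. *)
Lemma star_one_inj w : supp_L1 w -> star one w = cst 0 %[ae mu] ->
  w = cst 0 %[ae mu].
Proof.
move=> Sw; have [iw _] := Sw => w0.
have iwS (D : set R) : measurable D -> mu.-integrable D (EFin \o w).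
  by move=> mD; apply: integrableS iw.
pose P t := \int[mu]_(s in `]-oo, t]) w s.
have lw : locally_integrable [set: R] w.
  by apply: open_integrable_locally => //; exact: openT.
have P0 : \forall t \ae mu, 0 < t < b -> P t = 0.
  move: w0; apply: filterS => t /(_ Logic.I) w0 tb.
  by rewrite /P -Rintegral_itv_bndo_bndc -?star_one//; exact: iwS.
have nopos (Q : R -> R) (l t : R) :
    (\forall s \ae mu, 0 < s < b -> Q s = 0) -> Q t = 0 ->
    0 < t < b -> is_derive t 1 Q l -> 0 < l -> False.
  move=> Q0 Qt /andP[t0 tb] dQ l0.
  have [d /= d0 dQs] := right_increase_of_derive_gt0 dQ l0.
  have te : t < Num.min (t + d) b by rewrite lt_min ltrDl d0.
  have [s /andP[ts]] := ae_exists_in_itv te Q0.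
  rewrite lt_min => /andP[std sb]; rewrite (lt_trans t0 ts) sb => /(_ isT) Qs.
  have := dQs s; rewrite /= distrC gtr0_norm ?subr_gt0// ltrBlDl => /(_ std ts).
  by rewrite Qs Qt ltxx.
have := @FTC1Ny _ w (fun y => iwS _ (measurable_itv _)) lw.
move: (P0); apply: filterS2 => t Pt0 [dP wt] _.
have [tb|tb] := boolP (0 < t < b); last exact: supp_L1_eq0 Sw tb.
have {}dP : is_derive t 1 P (w t) by rewrite -wt derive1E; exact: derivableP.
have [wn|wp|->//] := ltgtP (w t) 0; exfalso.
  have dNP : is_derive t 1 (- P) (- w t) by exact: is_deriveN.
  apply: (nopos (- P) (- w t) t _ _ tb dNP).
  - move: P0; apply: filterS => s /[apply] Ps.
    by rewrite -[LHS]/(- P s) Ps oppr0.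
  - by rewrite -[LHS]/(- P t) Pt0// oppr0.
  - by rewrite oppr_gt0.
exact: (nopos P (w t) t P0 (Pt0 tb) tb dP wp).
Qed.

Lemma cutoff_primitive f : 0 < b -> {within `[0, b], continuous f} ->
  {in `]0, b[, forall t, derivable f t 1} -> L1_on b f^`()%classic ->
  cutoff f = (fun t => f 0 * one t + star one (cutoff f^`()%classic) t).
Proof.
move=> b0 cf df if'; apply/funext => t.
have Sf' := cutoff_supp_L1 if'.
have [tb|tb] := boolP (0 < t < b); last first.
  by rewrite star0// !cutoff0// mulr0 addr0.
rewrite star_one// !cutoffE// mulr1.
apply/eqP; rewrite addrC -subr_eq; apply/eqP.
have /andP[t0 t_b] := tb.
have sub : `]0, t[ `<=` `]0, b[ by apply: subset_itvl; rewrite bnd_simp ltW.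
rewrite integral_derive1//; first last.
- exact: (@integrableS _ _ _ mu `]0, b[%classic _ _
    (measurable_itv _) (measurable_itv _) sub if').
- by move=> s s0t; apply: df; exact: sub.
- by apply: continuous_subspaceW cf; apply: subset_itvl; rewrite bnd_simp ltW.
rewrite Rintegral_mkcond [RHS]Rintegral_mkcond; apply: eq_Rintegral => s _.
rewrite !patchE !mem_setE !in_itv/=.
have [s0|s0] := leP s 0.
  by rewrite /= cutoff0 ?if_same// negb_and -leNgt s0.
by case: (ltP s t) => // st; rewrite cutoffE ?s0 ?(lt_trans st).
Qed.

End Primitive.

(** * Functions of class C^1 up to the boundary *)

Section C1.
Context {R : realType}.
Notation mu := (@lebesgue_measure R).

Lemma C1_on_derivable a b (f df : R -> R) :
  {in `[a, b], forall x,
    (f y - f x) / (y - x) @[y --> within `[a, b] x^'] --> df x} ->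
  {in `]a, b[, forall x : R, is_derive x (1 : R) f (df x)}.
Proof.
move=> qf x xab.
have xab' : x \in `[a, b] by exact: subset_itv_oo_cc.
suff fl : h^-1 *: ((f \o shift x) (h *: 1) - f x) @[h --> 0^'] --> df x.
  by apply: DeriveDef; [apply/cvg_ex; exists (df x)|exact: cvg_lim].
apply/cvgrPdist_lt => e e0; have /cvgrPdist_lt/(_ e e0) := qf x xab'.
have : \forall y \near x, y \in `]a, b[ by exact: near_in_itvoo.
move=> [d1 /= d10 H1] [d2 /= d20 H2].
exists (Num.min d1 d2); first by rewrite /= lt_min d10.
move=> h /=; rewrite sub0r normrN lt_min => /andP[hd1 hd2] h0.
have xhx : x - (h + x) = - h by ring.
have := H2 (h + x); rewrite /= xhx normrN => /(_ hd2).
rewrite -subr_eq0 addrK => /(_ h0).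
rewrite /shift /= [_ *: 1]mulr1 [_ *: _]mulrC; apply.
apply: subset_itv_oo_cc; apply: H1.
by rewrite /= xhx normrN.
Qed.

Lemma cvg_of_difference_quotient (f : R -> R) (x l : R) F : Filter F ->
  (f y - f x) / (y - x) @[y --> F] --> l -> F --> x ->
  (\forall y \near F, y != x) -> f @ F --> f x.
Proof.
move=> FF q Fx Fnx.
have : f x + (f y - f x) / (y - x) * (y - x) @[y --> F] --> f x + l * (x - x).
  apply: cvgD; first exact: cvg_cst.
  by apply: cvgM => //; apply: cvgB => //; exact: cvg_cst.
rewrite subrr mulr0 addr0; apply: cvg_trans; apply: near_eq_cvg.
by apply: filterS Fnx => y yx; rewrite divfK ?subr_eq0// addrC subrK.
Qed.

Lemma C1_on_continuous a b (f df : R -> R) : a < b ->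
  {in `[a, b], forall x,
    (f y - f x) / (y - x) @[y --> within `[a, b] x^'] --> df x} ->
  {within `[a, b], continuous f}.
Proof.
move=> ab qf; apply/(continuous_within_itvP _ ab); split.
- move=> x xab; have [dfx _] := C1_on_derivable qf xab.
  exact/differentiable_continuous/derivable1_diffP.
- have aab : a \in `[a, b] by rewrite in_itv/= lexx ltW.
  apply: (@cvg_of_difference_quotient f a (df a)).
  + apply: cvg_trans (qf a aab) => A [d /= d0 dA].
    exists (Num.min d (b - a)); first by rewrite /= lt_min d0 subr_gt0.
    move=> y /=; rewrite lt_min => /andP[yd yb] ay; apply: dA => //.
      by rewrite gt_eqF.
    rewrite /= in_itv/= (ltW ay)/=.
    by move: yb; rewrite distrC gtr0_norm ?subr_gt0// ltrD2r => /ltW.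
  + by apply: cvg_within.
  + by near=> y; rewrite gt_eqF.
- have bab : b \in `[a, b] by rewrite in_itv/= lexx ltW.
  apply: (@cvg_of_difference_quotient f b (df b)).
  + apply: cvg_trans (qf b bab) => A [d /= d0 dA].
    exists (Num.min d (b - a)); first by rewrite /= lt_min d0 subr_gt0.
    move=> y /=; rewrite lt_min => /andP[yd yb] ay; apply: dA => //.
      by rewrite lt_eqF.
    rewrite /= in_itv/= (ltW ay) andbT.
    by move: yb; rewrite gtr0_norm ?subr_gt0// ltrD2l ltrN2 => /ltW.
  + by apply: cvg_within.
  + by near=> y; rewrite lt_eqF.
Unshelve. all: by end_near. Qed.

Lemma C1_on_differentiable b (f : R -> R) : 0 < b -> C1_on 0 b f ->
  [/\ {within `[0, b], continuous f}, {in `]0, b[, forall t, derivable f t 1} &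
    L1_on b f^`()%classic].
Proof.
move=> b0 [df cdf qf]; have dfi := C1_on_derivable qf.
split; first exact: C1_on_continuous qf.
  by move=> t tb; have [] := dfi t tb.
have idf : mu.-integrable `[0, b] (EFin \o df).
  by apply: continuous_compact_integrable => //; exact: segment_compact.
apply: (@eq_integrable _ _ _ mu _ (measurable_itv _) (EFin \o df)).
  move=> t /set_mem tb /=; rewrite derive1E.
  by rewrite (@derive_val _ _ _ _ _ _ _ (dfi t tb)).
by apply: integrableS idf => //; exact: subset_itv_oo_cc.
Qed.

End C1.

(** * Sonine pairs *)

Section Main.
Context {R : realType}.
Notation mu := (@lebesgue_measure R).
Implicit Types u v w : R -> R.
Variable b : R.
Notation supp_L1 := (supp_L1 b).
Notation star := (star b).
Notation cutoff := (cutoff b).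
Notation one := (cutoff (cst 1)).

Lemma star_zero (a w : R -> R) : supp_L1 a -> supp_L1 w ->
  w = cst 0 %[ae mu] -> star a w = cst 0 %[ae mu].
Proof.
move=> Sa Sw w0.
have w0w : w = (fun t => -1 * w t + w t) %[ae mu].
  by move: w0; apply: filterS => t /(_ Logic.I) -> _; rewrite /= mulr0 addr0.
rewrite (eq_starr Sa Sw (supp_L1D (supp_L1Z (-1) Sw) Sw) w0w).
move: (star_linear (-1) Sa Sw Sw); apply: filterS => t /(_ Logic.I) -> _.
by rewrite mulN1r addNr.
Qed.

Lemma star_primitive h w : supp_L1 h -> supp_L1 w ->
  star (fun t => one t + star one h t) w =
  star one (fun t => w t + star h w t) %[ae mu].
Proof.
move=> Sh Sw; have S1 := supp_L1_one b.
have S1h := supp_L1_star S1 Sh; have Shw := supp_L1_star Sh Sw.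
rewrite (starC (supp_L1D S1 S1h) Sw).
move: (starD Sw S1 S1h) (starD S1 Sw Shw) (starA S1 Sh Sw).
apply: filterS3 => t /(_ Logic.I) -> /(_ Logic.I) -> /(_ Logic.I) -> _.
by rewrite (starC Sw S1) (starC Sw S1h).
Qed.

Lemma sonine_star (A B h w : R -> R) :
  supp_L1 A -> supp_L1 B -> supp_L1 h -> supp_L1 w ->
  star A B = (fun t => one t + star one h t) %[ae mu] ->
  star A (star B w) = star one (fun t => w t + star h w t) %[ae mu].
Proof.
move=> SA SB Sh Sw AB; have S1 := supp_L1_one b.
have SG := supp_L1D S1 (supp_L1_star S1 Sh).
move: (starA SA SB Sw) (star_primitive Sh Sw).
rewrite (eq_starl (supp_L1_star SA SB) SG Sw AB).
by apply: filterS2 => t /(_ Logic.I) -> /(_ Logic.I) -> _.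
Qed.

(** Applying A turns B * w = 0 into 1 * (w + h * w) = 0, and neither factor
    annihilates anything: differentiate, then use uniqueness for the equation
    of the second kind. *)
Lemma sonine_kernel_inj (A B h w : R -> R) :
  supp_L1 A -> supp_L1 B -> supp_L1 h -> supp_L1 w ->
  star A B = (fun t => one t + star one h t) %[ae mu] ->
  star B w = cst 0 %[ae mu] -> w = cst 0 %[ae mu].
Proof.
move=> SA SB Sh Sw AB Bw; apply: (volterra_uniq Sh Sw).
apply: star_one_inj; first exact: supp_L1D (supp_L1_star Sh Sw).
move: (star_zero SA (supp_L1_star SB Sw) Bw) (sonine_star SA SB Sh Sw AB).
by apply: filterS2 => t /(_ Logic.I) <- /(_ Logic.I) <-.
Qed.

(** The right-hand side is a function with value c at 0 and derivative phi. If
    B * u = f then 1 * (u + h * u) = A * f = 1 * (c A + A * phi), which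
    dictates u; that this u is a solution follows because A can be
    cancelled. *)
Lemma sonine_equation_solvable (A B h phi : R -> R) (c : R) :
  supp_L1 A -> supp_L1 B -> supp_L1 h -> supp_L1 phi ->
  star A B = (fun t => one t + star one h t) %[ae mu] ->
  exists u, supp_L1 u /\
    star B u = (fun t => c * one t + star one phi t) %[ae mu].
Proof.
move=> SA SB Sh Sphi AB; have S1 := supp_L1_one b.
have SAphi := supp_L1_star SA Sphi; have S1phi := supp_L1_star S1 Sphi.
have SF := supp_L1D (supp_L1Z c SA) SAphi.
have Sf := supp_L1D (supp_L1Z c S1) S1phi.
have [u [Su uF]] := volterra Sh SF.
exists u; split => //.
have SBu := supp_L1_star SB Su.
pose r t := -1 * (c * one t + star one phi t) + star B u t.
have Sr : supp_L1 r by exact: supp_L1D (supp_L1Z _ Sf) SBu.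
have BA : star B A = (fun t => one t + star one h t) %[ae mu].
  by rewrite (starC SB SA).
suff : r = cst 0 %[ae mu].
  apply: filterS => t /(_ Logic.I) /eqP.
  by rewrite /r /= mulN1r addrC subr_eq0 => /eqP.
apply: (sonine_kernel_inj SB SA Sh Sr BA).
have ABu := sonine_star SA SB Sh Su AB.
rewrite (eq_starr S1 (supp_L1D Su (supp_L1_star Sh Su)) SF uF) in ABu.
have Af : star A (fun t => c * one t + star one phi t) =
    star one (fun t => c * A t + star A phi t) %[ae mu].
  move: (star_linear c SA S1 S1phi) (star_linear c S1 SA SAphi).
  move: (starCA SA S1 Sphi); apply: filterS3 => t.
  move=> /(_ Logic.I) eC /(_ Logic.I) eA /(_ Logic.I) e1 _.
  rewrite eA e1 eC (starC S1 SA).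
  reflexivity.
move: (star_linear (-1) SA Sf SBu) ABu Af; apply: filterS3 => t.
move=> /(_ Logic.I) eA /(_ Logic.I) eu /(_ Logic.I) ef _.
by rewrite eA eu ef mulN1r addNr.
Qed.

End Main.

Theorem theorem3p3 (R : realType) (b : R) (k f : R -> R) (hb : 0 < b)
  (hk : L1_on b k) (hgSC : gSC b k) (hf : C1_on 0 b f) :
  exists u : R -> R,
    [/\ L1_on b u,
        convolution_eq b k u f &
        forall v : R -> R,
          L1_on b v -> convolution_eq b k v f -> eq_ae_on b v u].
Proof.
have [K [g [iK cg dg ig' [g0 Kkg]]]] := hgSC.
have [cf df if'] := C1_on_differentiable hb hf.
have fE := cutoff_primitive hb cf df if'.
have Sk := cutoff_supp_L1 hk; have SK := cutoff_supp_L1 iK.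
have Sg' := cutoff_supp_L1 ig'; have Sf' := cutoff_supp_L1 if'.
move/(convolution_eqP _ iK hk): Kkg.
rewrite (cutoff_primitive hb cg dg ig') g0.
under [X in _ = X %[ae _] -> _]eq_fun do rewrite mul1r.
move=> Kkg.
have [u [Su ku]] := sonine_equation_solvable (f 0) SK Sk Sg' Sf' Kkg.
have [_ cu] := Su; have iu := supp_L1_on Su.
exists u; split => //.
  by apply/(convolution_eqP _ hk iu); rewrite cu fE.
move=> v iv /(convolution_eqP _ hk iv); rewrite fE => kv.
have Sv := cutoff_supp_L1 iv; have SNu := supp_L1Z (-1) Su.
have w0 : (fun t => -1 * u t + cutoff b v t) = cst 0 %[ae lebesgue_measure].
  apply: (sonine_kernel_inj SK Sk Sg' (supp_L1D SNu Sv) Kkg).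
  move: (star_linear (-1) Sk Su Sv) ku kv; apply: filterS3 => t.
  move=> /(_ Logic.I) ekw /(_ Logic.I) eku /(_ Logic.I) ekv _.
  by rewrite ekw eku ekv mulN1r addNr.
apply/cutoff_aeP; rewrite cu; move: w0; apply: filterS => t /(_ Logic.I) /eqP.
by rewrite /= mulN1r addrC subr_eq0 => /eqP.
Qed.
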